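(* Let $n\ge 1$, let $A\in\mathbb{C}^{n\times n}$, and set $A_0=I_n$, $A_1=\frac{A+A^*}{2}$, $A_2=\frac{A-A^*}{2i}$. Let $\mathcal{F}(A)=\{y=(y_0,y_1,y_2)\in\mathbb{R}^3 : y_0A_0+y_1A_1+y_2A_2\succeq 0\}$ and let $\mathcal{F}(A)^*=\{x\in\mathbb{R}^3 : x_0y_0+x_1y_1+x_2y_2\ge 0 \text{ for all } y\in\mathcal{F}(A)\}$ be its dual cone. Then $$\mathcal{F}(A)^*=\{(\langle A_0,W\rangle,\langle A_1,W\rangle,\langle A_2,W\rangle) : W\in\mathbb{C}^{n\times n},\ W\succeq 0\},$$ and the numerical range $\mathcal{W}(A)=\{w^*Aw : w\in\mathbb{C}^n,\ w^*w=1\}$ equals this set under the identification of $\mathbb{C}$ with the affine chart $x_0=1$, that is, for all $x_1,x_2\in\mathbb{R}$, $$x_1+ix_2\in\mathcal{W}(A)\iff (1,x_1,x_2)\in\mathcal{F}(A)^*.$$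
   Context: Here $i$ is the imaginary unit, $I_n$ is the identity matrix of size $n$, $A^*$ is the conjugate transpose, and $M\succeq 0$ means that $M$ is Hermitian positive semidefinite. The matrices $A_0,A_1,A_2$ are Hermitian. For matrices, $\langle X,Y\rangle=\mathrm{trace}(X^*Y)$. Points of the complex plane $x_1+ix_2$ are identified with points $(x_1,x_2)$ of $\mathbb{R}^2$ and with points of projective coordinates $(1,x_1,x_2)$ in the real projective plane; subsets of the projective plane are represented by cones in $\mathbb{R}^3$. *)

(* Defs.v *)
From mathcomp Require Import all_boot all_order all_algebra.
From mathcomp Require Import classical_sets reals.
From mathcomp Require Import complex.

Set Implicit Arguments.
Unset Strict Implicit.
Unset Printing Implicit Defensive.

Import Order.TTheory GRing.Theory Num.Theory.
Local Open Scope ring_scope.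
Local Open Scope sesquilinear_scope.
Local Open Scope complex_scope.

(* In [R[i]], [0 <= z] says that [z] is real and nonnegative. *)
Definition psdmx (R : realType) (n : nat) (M : 'M[R[i]]_n) : Prop :=
  M \is hermsymmx /\ forall v : 'cV[R[i]]_n, 0 <= (v^t* *m M *m v) 0 0.

Definition frob (R : realType) (n : nat) (X Y : 'M[R[i]]_n) : R[i] :=
  \tr (X^t* *m Y).

(* The triple (A_0, A_1, A_2), indexed by 'I_3. *)
Definition herm_parts (R : realType) (n : nat) (A : 'M[R[i]]_n) (j : 'I_3) :
    'M[R[i]]_n :=
  match val j with
  | 0 => 1%:M
  | 1 => 2^-1 *: (A + A^t* )
  | _ => (2 * 'i)^-1 *: (A - A^t* )
  end.

Definition lmi_cone (R : realType) (n : nat) (A : 'M[R[i]]_n) :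
    set 'rV[R]_3 :=
  [set y | psdmx (\sum_(j < 3) (y 0 j)%:C *: herm_parts A j)]%classic.

Definition dual_cone (R : realType) (m : nat) (K : set 'rV[R]_m) :
    set 'rV[R]_m :=
  [set x | forall y, K y -> 0 <= \sum_(j < m) x 0 j * y 0 j]%classic.

(* The inner products are complex numbers (real-valued when W is Hermitian),
   so that they are compared with the embedded real coordinates of x. *)
Definition psd_image (R : realType) (n : nat) (A : 'M[R[i]]_n) :
    set 'rV[R]_3 :=
  [set x | exists2 W : 'M[R[i]]_n, psdmx W &
     forall j : 'I_3, (x 0 j)%:C = frob (herm_parts A j) W]%classic.

Definition numerical_range (R : realType) (n : nat) (A : 'M[R[i]]_n) :
    set R[i] :=
  [set z | exists2 w : 'cV[R[i]]_n, w^t* *m w = 1%:M &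
     z = (w^t* *m A *m w) 0 0]%classic.

Definition point3 (R : realType) (x0 x1 x2 : R) : 'rV[R]_3 :=
  \row_(j < 3) [:: x0; x1; x2]`_j.

(* Main.v *)
(** Let q(w) be the vector of the three real numbers w^* A_j w. By the
    Toeplitz-Hausdorff argument the sum of two values of q is again a value of
    q, so the values of q form a convex cone C in R^3. It is closed, because its
    zeroth coordinate |w|^2 controls w, so every point x has a closest point p
    in C; then p - x is nonnegative on C, i.e. lies in F(A), and is orthogonal
    to p, whence <x, p - x> = - |p - x|^2. So x in F(A)^* forces x = p. The
    reverse inclusions follow from tr(Y W) >= 0 for positive semidefinite Y and
    W. *)

Require Import Defs.
From mathcomp Require Import all_boot all_order all_algebra.
From mathcomp Require Import classical_sets reals.
From mathcomp Require Import complex.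
From mathcomp Require Import boolp topology normedtype derive.
From mathcomp Require Import ring lra.

Set Implicit Arguments.
Unset Strict Implicit.
Unset Printing Implicit Defensive.

Import Order.TTheory GRing.Theory Num.Theory.
Local Open Scope ring_scope.
Local Open Scope sesquilinear_scope.

(** * Sesquilinear forms and the Toeplitz-Hausdorff argument *)

Section Form.
Variables (C : numClosedFieldType) (n : nat).
Implicit Types (M N : 'M[C]_n) (u v w : 'cV[C]_n) (c : C).

Definition hform M u v : C := (u^t* *m M *m v) 0 0.

Lemma hformDl M u1 u2 v : hform M (u1 + u2) v = hform M u1 v + hform M u2 v.
Proof. by rewrite /hform linearD /= map_mxD !mulmxDl mxE. Qed.

Lemma hformDr M u v1 v2 : hform M u (v1 + v2) = hform M u v1 + hform M u v2.
Proof. by rewrite /hform mulmxDr mxE. Qed.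

Lemma hformZl M c u v : hform M (c *: u) v = c^* * hform M u v.
Proof. by rewrite /hform linearZ /= map_mxZ -!scalemxAl mxE. Qed.

Lemma hformZr M c u v : hform M u (c *: v) = c * hform M u v.
Proof. by rewrite /hform -scalemxAr mxE. Qed.

Lemma hformDm M N u v : hform (M + N) u v = hform M u v + hform N u v.
Proof. by rewrite /hform mulmxDr mulmxDl mxE. Qed.

Lemma hformZm c M u v : hform (c *: M) u v = c * hform M u v.
Proof. by rewrite /hform -scalemxAr -scalemxAl mxE. Qed.

Lemma hform_summ (I : finType) (M : I -> 'M[C]_n) u v :
  hform (\sum_i M i) u v = \sum_i hform (M i) u v.
Proof. by rewrite /hform mulmx_sumr mulmx_suml summxE. Qed.

Lemma hform_adj M u v : hform (M^t* ) u v = (hform M v u)^*.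
Proof.
rewrite /hform -[LHS]conjCK; congr (_^*).
have -> : forall X : 'M[C]_1, (X 0 0)^* = (X^t* ) 0 0.
  by move=> X; rewrite !mxE.
by rewrite !trmx_mul !map_mxM !trmxCK mulmxA.
Qed.

Lemma hform1E w : hform 1%:M w w = \sum_i `|w i 0| ^+ 2.
Proof.
rewrite /hform mulmx1 mxE; apply: eq_bigr => i _.
by rewrite !mxE normCK mulrC.
Qed.

Lemma hform1_ge0 w : 0 <= hform 1%:M w w.
Proof. by rewrite hform1E; apply: sumr_ge0 => i _; rewrite exprn_ge0. Qed.

Lemma hform1_eq0 w : (hform 1%:M w w == 0) = (w == 0).
Proof.
apply/eqP/eqP => [|->]; last by rewrite /hform mulmx0 mxE.
rewrite hform1E => /psumr_eq0P w0.
apply/colP => i; rewrite mxE; apply/eqP.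
rewrite -normr_eq0 -sqrf_eq0; apply/eqP/w0 => // j _.
by rewrite exprn_ge0.
Qed.

(** Normalized core of the Toeplitz-Hausdorff argument: zero, which lies between the two values, is
    attained on the span of [u] and [v], although [M] need not be Hermitian. *)
Lemma hform_isotropic M u v :
  hform M u u = 1 -> hform M v v = -1 ->
  exists2 w, w != 0 & hform M w w = 0.
Proof.
move=> Muu Mvv.
set a := hform M u v; set b := hform M v u.
pose d := a - b^*.
(* The factor e makes k real; the value of the form at s u + e v, s real, is then
   the real quadratic s^2 + k s - |e|^2, which has a real root. *)
pose e := if d == 0 then 1 else d^*.
have e0 : e != 0 by rewrite /e; case: ifPn; rewrite ?oner_eq0 ?conjC_eq0.
have ed : e * d \is Num.real.
  rewrite /e; case: ifPn => [/eqP->|_]; first by rewrite mulr0 rpred0.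
  by rewrite mulrC -normCK rpredX ?normr_real.
pose k := e * a + e^* * b.
have kreal : k \is Num.real.
  (* [k] minus its conjugate equals [e * d] minus its conjugate. *)
  have : (e * d)^* = e * d by apply/CrealP.
  rewrite /d !(rmorphM, rmorphB) /= conjCK => H.
  apply/CrealP; rewrite /k rmorphD !rmorphM /= conjCK.
  by move/eqP: H; rewrite !mulrBr subr_eq => /eqP ->; ring.
pose D := k ^+ 2 + 4 * `|e| ^+ 2.
have D0 : 0 <= D.
  by rewrite addr_ge0 ?real_exprn_even_ge0 // mulr_ge0 ?ler0n // exprn_ge0.
pose s := (- k + sqrtC D) / 2.
have s_real : s^* = s.
  apply/CrealP; rewrite rpred_div ?realn // rpredD ?rpredN //.
  by rewrite ger0_real // sqrtC_ge0.
have sE : s ^+ 2 + k * s = `|e| ^+ 2.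
  have DE := sqrtCK D; rewrite {2}/D in DE.
  have -> : `|e| ^+ 2 = (sqrtC D ^+ 2 - k ^+ 2) / 4 by rewrite DE; field.
  by rewrite /s; field.
exists (s *: u + e *: v).
  (* If the vector vanished, the form at [s *: u] would be both s^2 and -|e|^2, forcing [e] to be
     zero. *)
  apply: contra e0 => /eqP /(canRL (addrK _)); rewrite sub0r => su.
  have : hform M (s *: u) (s *: u) = - `|e| ^+ 2.
    rewrite su -!scaleNr hformZl hformZr Mvv rmorphN /= normCK; ring.
  rewrite hformZl hformZr Muu s_real mulr1 -expr2 => /eqP.
  have s_ge0 : 0 <= s ^+ 2 by rewrite real_exprn_even_ge0 //; apply/CrealP.
  rewrite -addr_eq0 paddr_eq0 ?s_ge0 ?exprn_ge0 ?normr_ge0 // !sqrf_eq0 normr_eq0.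
  by case/andP.
rewrite !(hformDl, hformDr, hformZl, hformZr) s_real Muu Mvv -/a -/b.
transitivity (s ^+ 2 + k * s - e * e^* ); first by rewrite /k; ring.
by rewrite sE normCK subrr.
Qed.

(** Subtracting [m] times the identity makes the two values opposite. A nonzero isotropic vector of
    the shifted form, rescaled to squared norm [T], then has value [m * T], the required sum. *)
Lemma toeplitz_hausdorff M u v :
  exists w, hform 1%:M w w = hform 1%:M u u + hform 1%:M v v /\
            hform M w w = hform M u u + hform M v v.
Proof.
set T := hform 1%:M u u + hform 1%:M v v.
have [/eqP|T0] := eqVneq T 0.
  rewrite paddr_eq0 ?hform1_ge0 // !hform1_eq0 => /andP[/eqP u0 /eqP v0].
  by exists 0; rewrite /T u0 v0 /hform !mulmx0 !mxE addr0.
pose m := (hform M u u + hform M v v) / T.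
pose N := M + (- m) *: 1%:M.
have NE w : hform M w w = hform N w w + m * hform 1%:M w w.
  by rewrite hformDm hformZm; ring.
have Nuv : hform N v v = - hform N u u.
  apply/eqP; rewrite -addr_eq0 !hformDm !hformZm /m; apply/eqP.
  rewrite addrACA -mulrDr -/T.
  rewrite (addrC (hform 1%:M v v)) mulNr mulfVK //; ring.
suff [w w0 Nw] : exists2 w, w != 0 & hform N w w = 0.
  have w1 : hform 1%:M w w != 0 by rewrite hform1_eq0.
  pose r := sqrtC (T / hform 1%:M w w).
  have rr : r^* * r = T / hform 1%:M w w.
    have T_ge0 : 0 <= T by rewrite addr_ge0 ?hform1_ge0.
    rewrite (CrealP _) -?expr2 ?sqrtCK //.
    by rewrite ger0_real // sqrtC_ge0 divr_ge0 ?hform1_ge0.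
  have w1E : hform 1%:M (r *: w) (r *: w) = T.
    by rewrite hformZl hformZr mulrA rr mulfVK.
  exists (r *: w); split => //.
  rewrite NE w1E hformZl hformZr Nw !mulr0 add0r /m mulfVK //.
(* If the value at [u] is zero, so is the value at [v], and [T0] ensures that one of the two vectors
   is nonzero. *)
have [Nu|Nu] := eqVneq (hform N u u) 0.
  have [u0|u0] := eqVneq u 0; last by exists u.
  exists v; last by rewrite Nuv Nu oppr0.
  apply: contra T0 => /eqP v0.
  by rewrite /T u0 v0 /hform !mulmx0 !mxE addr0.
(* Dividing by the value at [u], possibly complex, normalizes the two values to 1 and -1 and keeps
   the same isotropic vectors. *)
have [||w w0] := @hform_isotropic ((hform N u u)^-1 *: N) u v.
- by rewrite hformZm mulVf.
- by rewrite hformZm Nuv mulrN mulVf.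
rewrite hformZm => /eqP; rewrite mulf_eq0 invr_eq0 (negPf Nu) /= => /eqP Nw.
by exists w.
Qed.

End Form.

(** * The joint form, positive semidefinite matrices and the easy inclusions *)

Section JointForm.
Variables (R : realType) (n : nat).
Implicit Types (A M Y W : 'M[R[i]]_n) (u v w : 'cV[R[i]]_n).

Lemma hermsymmxE M : (M \is hermsymmx) = (M == M^t* ).
Proof. by rewrite is_hermitianmxE expr0 scale1r. Qed.

Lemma conj_realC (r : R) : (r%:C%C)^* = r%:C%C.
Proof. exact: conjc_real. Qed.

Lemma adjmx_realZ (r : R) M : (r%:C%C *: M)^t* = r%:C%C *: M^t*.
Proof. by rewrite linearZ /= map_mxZ; congr (_ *: _); exact: conj_realC. Qed.

Lemma herm_parts_adj A j : (herm_parts A j)^t* = herm_parts A j.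
Proof.
rewrite /herm_parts; case: (val j) => [|[|_]].
- by rewrite trmx1 map_mx1.
- rewrite linearZ /= map_mxZ linearD /= map_mxD trmxCK addrC.
  by rewrite fmorphV rmorph_nat.
- rewrite linearZ /= map_mxZ linearB /= map_mxB trmxCK -opprB scalerN -scaleNr.
  by rewrite fmorphV rmorphM rmorph_nat /= conjCi mulrN invrN opprK.
Qed.

Lemma herm_parts_decomp A :
  A = herm_parts A 1 + 'i *: herm_parts A (inord 2).
Proof.
rewrite /herm_parts /= inordK //=.
rewrite scalerA invfM mulrCA divff ?neq0Ci // mulr1 -scalerDr.
by rewrite addrCA addrK -mulr2n -(scaler_nat _ A) scalerA mulVf ?scale1r ?pnatr_eq0.
Qed.

Lemma herm_form_real M w : M^t* = M -> hform M w w \is Num.real.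
Proof. by move=> MM; apply/CrealP; rewrite -hform_adj MM. Qed.

(** This is q(w). Taking real parts loses nothing, since the three matrices are Hermitian. *)
Definition joint_form A w : 'rV[R]_3 :=
  \row_j complex.Re (hform (herm_parts A j) w w).

Lemma joint_formE A w j :
  (joint_form A w 0 j)%:C%C = hform (herm_parts A j) w w.
Proof. by rewrite mxE RRe_real // herm_form_real // herm_parts_adj. Qed.

(** The value of the adjoint of [A] is the conjugate of the value of [A], so all three coordinates
    are additive as soon as the values of the identity and of [A] are. *)
Lemma joint_formD A u v :
  exists w, joint_form A w = joint_form A u + joint_form A v.
Proof.
have [w [w1 wA]] := toeplitz_hausdorff A u v.
exists w; apply/rowP => j; apply: complexI.
rewrite [in RHS]mxE rmorphD /= !joint_formE /herm_parts.
case: (val j) => [|[|_]].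
- exact: w1.
- by rewrite !(hformZm, hformDm) !hform_adj wA rmorphD /=; ring.
- rewrite -(scaleN1r (A^t* )) !(hformZm, hformDm) !hform_adj wA rmorphD /=; ring.
Qed.

Lemma joint_formZ A (t : R) u : 0 <= t ->
  joint_form A ((Num.sqrt t)%:C%C *: u) = t *: joint_form A u.
Proof.
move=> t0; apply/rowP => j; apply: complexI.
rewrite [in RHS]mxE rmorphM /= !joint_formE hformZl hformZr conj_realC.
by rewrite mulrA -rmorphM /= -expr2 sqr_sqrtr.
Qed.

Lemma frob_outer Y w : Y^t* = Y -> frob Y (w *m w^t* ) = hform Y w w.
Proof.
move=> YY; rewrite /frob YY mulmxA mxtrace_mulC mulmxA.
by rewrite /mxtrace big_ord1.
Qed.

Lemma psdmx_outer w : psdmx (w *m w^t* ).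
Proof.
split.
  by rewrite hermsymmxE trmx_mul map_mxM trmxCK.
move=> v; rewrite !mulmxA -mulmxA.
have -> : v^t* *m w = (w^t* *m v)^t* by rewrite trmx_mul map_mxM trmxCK.
by rewrite mxE big_ord1 !mxE mulrC mul_conjC_ge0.
Qed.

(** Diagonalizing [W] in a unitary basis turns the trace into a sum of eigenvalues of [W] times
    values of the form of [Y] at the eigenvectors. *)
Lemma frob_psd_ge0 Y W : psdmx Y -> psdmx W -> 0 <= frob Y W.
Proof.
move=> [+ Ypsd] [Wherm Wpsd]; rewrite hermsymmxE => /eqP YY.
set P := spectralmx W; set d := spectral_diag W.
have PU : P *m P^t* = 1%:M by apply/unitarymxP/spectral_unitarymx.
have WE : W = P^t* *m diag_mx d *m P.
  rewrite -invmx_unitary ?spectral_unitarymx //.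
  exact/orthomx_spectralP/hermitian_normalmx.
have hP (M : 'M_n) k : (P *m M *m P^t* ) k k = hform M ((row k P)^t* ) ((row k P)^t* ).
  rewrite /hform trmxCK -row_mul.
  by rewrite !mxE; apply: eq_bigr => i _; rewrite !mxE.
have d_ge0 k : 0 <= d 0 k.
  suff -> : d 0 k = (P *m W *m P^t* ) k k by rewrite hP; exact: Wpsd.
  rewrite WE !mulmxA PU mul1mx -mulmxA PU mulmx1.
  by rewrite mxE eqxx mulr1n.
rewrite /frob -YY WE !mulmxA mxtrace_mulC !mulmxA.
rewrite mul_mx_diag /mxtrace; apply: sumr_ge0 => k _.
by rewrite mxE mulr_ge0 // hP; exact: Ypsd.
Qed.

(** A real combination of Hermitian matrices is Hermitian, so only the sign of its form matters.
    This exhibits [lmi_cone A] as the dual of the cone of values of [joint_form]. *)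
Lemma lmi_coneP A (y : 'rV[R]_3) :
  lmi_cone A y <-> forall w, 0 <= \sum_j joint_form A w 0 j * y 0 j.
Proof.
pose Y := \sum_(j < 3) (y 0 j)%:C%C *: herm_parts A j.
have YE w : hform Y w w = (\sum_j joint_form A w 0 j * y 0 j)%:C%C.
  rewrite rmorph_sum /Y hform_summ; apply: eq_bigr => j _.
  by rewrite hformZm -joint_formE mulrC -rmorphM.
split => [[_ Ypsd] w|y0].
  by rewrite -lecR -YE; exact: Ypsd.
split=> [|w]; last by rewrite -[X in 0 <= X]/(hform Y w w) YE lecR.
rewrite hermsymmxE linear_sum /= map_mx_sum; apply/eqP/eq_bigr => j _.
by rewrite adjmx_realZ herm_parts_adj.
Qed.

Lemma psd_image_dual A : (psd_image A `<=` dual_cone (lmi_cone A))%classic.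
Proof.
move=> x [W Wpsd xW] y Ypsd.
rewrite -lecR; have := frob_psd_ge0 Ypsd Wpsd.
rewrite /frob linear_sum /= map_mx_sum mulmx_suml linear_sum rmorph_sum /=.
congr (_ <= _); apply: eq_bigr => j _.
by rewrite adjmx_realZ -scalemxAl linearZ /= rmorphM /= xW mulrC.
Qed.

Lemma joint_form_psd_image A w : psd_image A (joint_form A w).
Proof.
exists (w *m w^t* ); first exact: psdmx_outer.
by move=> j; rewrite frob_outer ?herm_parts_adj // joint_formE.
Qed.

Lemma hform_joint A w :
  hform A w w = (joint_form A w 0 1 +i* joint_form A w 0 (inord 2))%C.
Proof.
rewrite {1}(herm_parts_decomp A) hformDm hformZm -!joint_formE.
by rewrite [RHS]complexE.
Qed.

(** Coordinate 0 is the squared norm of [w], so the chart at 1 selects unit vectors; the other two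
    are the real and imaginary parts of the value of [A]. *)
Lemma numerical_rangeP A (x1 x2 : R) :
  numerical_range A (x1 +i* x2)%C <->
  exists w, joint_form A w = point3 1 x1 x2.
Proof.
split=> [[w w1]|[w wx]].
  rewrite -[X in _ = X]/(hform A w w) hform_joint => -[x1E x2E].
  exists w; apply/rowP; case=> -[|[|[|//]]] lti; rewrite [RHS]mxE /=.
  - apply: complexI; rewrite joint_formE /herm_parts /= /hform mulmx1 w1.
    by rewrite mxE.
  - by rewrite x1E; congr (joint_form A w 0 _); apply: val_inj.
  - by rewrite x2E; congr (joint_form A w 0 _); apply: val_inj; rewrite /= inordK.
exists w; last first.
  by rewrite -[RHS]/(hform A w w) hform_joint wx !mxE /= inordK.
apply/matrixP => i j; rewrite !ord1 [RHS]mxE.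
have := joint_formE A w 0; rewrite wx mxE /= /herm_parts /= /hform mulmx1.
by move <-.
Qed.

End JointForm.

Import numFieldNormedType.Exports.

(** * Continuity, existence of a closest point, and the dual cone *)

Section Closest.
Variables (R : realType) (n : nat).
Local Open Scope classical_set_scope.

(** Real coordinates on complex vectors, so that compactness is used for boxes of real rows. *)
Definition cplx_col (r : 'rV[R]_(n + n)) : 'cV[R[i]]_n :=
  \col_i (r 0 (lshift n i) +i* r 0 (rshift n i))%C.

Lemma cplx_col_surj (w : 'cV[R[i]]_n) : exists r, w = cplx_col r.
Proof.
exists (row_mx (\row_i complex.Re (w i 0)) (\row_i complex.Im (w i 0))).
apply/colP => i; rewrite mxE row_mxEl row_mxEr !mxE.
by case: (w i 0).
Qed.

Definition cplx_continuous (T : topologicalType) (f : T -> R[i]) :=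
  continuous (fun t => complex.Re (f t)) /\
  continuous (fun t => complex.Im (f t)).

Lemma cplx_continuous_cst (T : topologicalType) (c : R[i]) :
  cplx_continuous (fun _ : T => c).
Proof. by split=> t; exact: cvg_cst. Qed.

Lemma cplx_continuousD (T : topologicalType) (f g : T -> R[i]) :
  cplx_continuous f -> cplx_continuous g ->
  cplx_continuous (fun t => f t + g t).
Proof.
move=> [fr fi] [gr gi].
have ReD (x y : R[i]) : complex.Re (x + y) = complex.Re x + complex.Re y.
  by case: x y => ? ? [].
have ImD (x y : R[i]) : complex.Im (x + y) = complex.Im x + complex.Im y.
  by case: x y => ? ? [].
split=> t.
  under eq_fun do rewrite ReD.
  by apply: cvgD; [exact: fr|exact: gr].
under eq_fun do rewrite ImD.
by apply: cvgD; [exact: fi|exact: gi].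
Qed.

Lemma cplx_continuousM (T : topologicalType) (f g : T -> R[i]) :
  cplx_continuous f -> cplx_continuous g ->
  cplx_continuous (fun t => f t * g t).
Proof.
move=> [fr fi] [gr gi].
have ReM (x y : R[i]) : complex.Re (x * y) =
    complex.Re x * complex.Re y - complex.Im x * complex.Im y.
  by case: x y => ? ? [].
have ImM (x y : R[i]) : complex.Im (x * y) =
    complex.Re x * complex.Im y + complex.Im x * complex.Re y.
  by case: x y => ? ? [].
split=> t.
  under eq_fun do rewrite ReM.
  by apply: cvgB; apply: cvgM; [exact: fr|exact: gr|exact: fi|exact: gi].
under eq_fun do rewrite ImM.
by apply: cvgD; apply: cvgM; [exact: fr|exact: gi|exact: fi|exact: gr].
Qed.

Lemma cplx_continuous_conj (T : topologicalType) (f : T -> R[i]) :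
  cplx_continuous f -> cplx_continuous (fun t => (f t)^*).
Proof.
move=> [fr fi].
have ReJ (x : R[i]) : complex.Re x^* = complex.Re x by case: x.
have ImJ (x : R[i]) : complex.Im x^* = - complex.Im x by case: x.
split=> t; first by under eq_fun do rewrite ReJ; exact: fr.
under eq_fun do rewrite ImJ.
by apply: cvgN; exact: fi.
Qed.

Lemma cplx_continuous_sum (T : topologicalType) (I : finType)
    (f : I -> T -> R[i]) :
  (forall i, cplx_continuous (f i)) -> cplx_continuous (fun t => \sum_i f i t).
Proof.
move=> fc; elim: (index_enum I) => [|i s IH].
  by under eq_fun do rewrite big_nil; exact: cplx_continuous_cst.
by under eq_fun do rewrite big_cons; exact: cplx_continuousD.
Qed.

Lemma hform_continuous (M : 'M[R[i]]_n) :
  cplx_continuous (fun r => hform M (cplx_col r) (cplx_col r)).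
Proof.
have cc i : cplx_continuous (fun r : 'rV_(n + n) => cplx_col r i 0).
  by split=> r; under eq_fun do rewrite mxE /=; exact: coord_continuous.
under eq_fun do rewrite /hform mxE.
apply: cplx_continuous_sum => k; apply: cplx_continuousM => //.
under eq_fun do rewrite mxE.
apply: cplx_continuous_sum => l; apply: cplx_continuousM.
  by under eq_fun do rewrite 2!mxE; apply: cplx_continuous_conj; exact: cc.
exact: cplx_continuous_cst.
Qed.

(** The distance is coercive: outside a large box it is at least its value at [w = 0], so a minimum
    over the compact box is global. *)
Lemma joint_form_closest (A : 'M[R[i]]_n) (x : 'rV[R]_3) :
  exists w0, forall w, \sum_j (joint_form A w0 0 j - x 0 j) ^+ 2 <=
                       \sum_j (joint_form A w 0 j - x 0 j) ^+ 2.
Proof.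
pose f w := \sum_j (joint_form A w 0 j - x 0 j) ^+ 2.
have jc j : continuous (fun r => joint_form A (cplx_col r) 0 j).
  under eq_fun do rewrite mxE.
  exact: (hform_continuous (herm_parts A j)).1.
have fc : continuous (fun r => f (cplx_col r)).
  apply: continuous_big => [|j _ r]; first exact: add_continuous.
  have jxc := continuousB (jc j r) (@cst_continuous _ _ (x 0 j) r).
  by under eq_fun do rewrite expr2; exact: (continuousM jxc jxc).
(* As [B] is at least 1, a real coordinate beyond [B] gives a squared norm of at least [B].
   Coordinate 0 then differs from that of [x] by at least [f 0 + 1], whose square exceeds [f 0]. *)
pose B := `|x 0 0| + f 0 + 1.
have f_ge0 w : 0 <= f w by apply: sumr_ge0 => j _; exact: sqr_ge0.
pose K := [set r : 'rV[R]_(n + n) | forall i, `[- B, B] (r 0 i)].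
have Kc : compact K.
  apply: (@rV_compact _ _ (fun=> `[- B, B])) => i; exact: segment_compact.
have B_ge1 : 1 <= B by rewrite lerDr addr_ge0.
have K0 : K 0.
  move=> i; rewrite /= mxE in_itv /= oppr_le0.
  by rewrite (le_trans ler01).
have [r0 _ r0min] : exists2 r0, r0 \in K & forall r, r \in K ->
    f (cplx_col r0) <= f (cplx_col r).
  apply: (@compact_EVT_min _ _ (fun r => f (cplx_col r))) => //.
    by exists 0.
  exact: continuous_subspaceT.
have c0 : cplx_col 0 = 0 by apply/colP => i; rewrite !mxE.
exists (cplx_col r0) => w; rewrite -/(f w) -/(f (cplx_col r0)).
have [r ->] := cplx_col_surj w.
have [rK|] := pselect (K r); first by apply: r0min; rewrite inE.
move=> /existsNP[i /negP]; rewrite in_itv /= -ler_norml -ltNge => Bri.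
apply: (@le_trans _ _ (f 0)).
  by rewrite -c0 r0min // inE.
have q0 : B <= joint_form A (cplx_col r) 0 0.
  apply: (@le_trans _ _ (`|r 0 i| ^+ 2)).
    apply: (@le_trans _ _ (B ^+ 2)).
      by rewrite expr2 ler_peMl // (le_trans ler01).
    by rewrite lerXn2r ?nnegrE // ?(le_trans ler01) // ltW.
  rewrite -lecR joint_formE /herm_parts /= hform1E.
  have mE k : `|cplx_col r k 0| ^+ 2 =
      (r 0 (lshift n k) ^+ 2 + r 0 (rshift n k) ^+ 2)%:C%C.
    by rewrite -add_Re2_Im2 mxE.
  have rest k : 0 <= \sum_(l | l != k) `|cplx_col r l 0| ^+ 2.
    by apply: sumr_ge0 => l _; rewrite exprn_ge0.
  rewrite real_normK ?num_real //.
  case: (split_ordP i) => k ->; rewrite (bigD1 k) //= mE.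
    by apply: ler_wpDr => //; rewrite lecR lerDl sqr_ge0.
  by apply: ler_wpDr => //; rewrite lecR lerDr sqr_ge0.
have q0x : f 0 + 1 <= joint_form A (cplx_col r) 0 0 - x 0 0.
  by have := ler_norm (x 0 0); move: q0; rewrite /B; lra.
have f0 := f_ge0 0.
apply: (@le_trans _ _ ((joint_form A (cplx_col r) 0 0 - x 0 0) ^+ 2)).
  by rewrite expr2; nra.
rewrite [leRHS]/f (bigD1 0) //= lerDl.
by apply: sumr_ge0 => j _; exact: sqr_ge0.
Qed.

(* At the point p of the cone closest to x, the vector p - x is nonnegative on
   the cone and orthogonal to p. *)
Lemma dual_cone_joint_form (A : 'M[R[i]]_n) (x : 'rV[R]_3) :
  dual_cone (lmi_cone A) x <-> exists w, x = joint_form A w.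
Proof.
split=> [xdual|[w ->]]; last exact/psd_image_dual/joint_form_psd_image.
have [w0 w0min] := joint_form_closest A x.
set p := joint_form A w0 in w0min; exists w0; rewrite -/p.
pose dot (y z : 'rV[R]_3) := \sum_j y 0 j * z 0 j.
have dot_exp (y : 'rV[R]_3) (t : R) :
    \sum_j (p 0 j + t * y 0 j - x 0 j) ^+ 2 =
    \sum_j (p 0 j - x 0 j) ^+ 2 + t * (2 * dot y (p - x) + t * dot y y).
  rewrite /dot !mulrDr !mulr_sumr -!big_split /=; apply: eq_bigr => j _.
  by rewrite !mxE; ring.
(* First-order optimality condition. The bound [t <= 1] allows variations that shrink [p] by the
   factor 1 - t. *)
have quad (a b : R) : 0 <= b ->
  (forall t, 0 < t -> t <= 1 -> 0 <= t * (2 * a + t * b)) -> 0 <= a.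
  move=> b0 H; rewrite leNgt; apply/negP => a0.
  have s0 : 0 < b - a by rewrite subr_gt0 (lt_le_trans a0).
  (* For this [t], 2a + tb equals a(1 + t), which is negative. *)
  pose t := - a / (b - a).
  have t0 : 0 < t by rewrite divr_gt0 // oppr_gt0.
  have t1 : t <= 1 by rewrite ler_pdivrMr // mul1r lerDr.
  have tE : t * (b - a) = - a by rewrite /t mulfVK ?gt_eqF.
  have := H _ t0 t1; rewrite pmulr_rge0 // => {}H.
  nra.
have dot_ge0 y : 0 <= dot y y.
  by apply: sumr_ge0 => j _; rewrite -expr2 sqr_ge0.
(* Adding a positive multiple of a value of [joint_form] to [p] stays in the cone, hence comes no
   closer to [x]. *)
have var w t : 0 < t ->
    0 <= t * (2 * dot (joint_form A w) (p - x)
        + t * dot (joint_form A w) (joint_form A w)).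
  move=> t0; rewrite -(lerD2l (\sum_j (p 0 j - x 0 j) ^+ 2)) addr0 -dot_exp.
  have [w' w'E] := joint_formD A w0 ((Num.sqrt t)%:C%C *: w).
  apply: le_trans (w0min w') _; rewrite w'E joint_formZ ?(ltW t0) //.
  apply: ler_sum => j _; rewrite /p.
  by move: (joint_form A w0) (joint_form A w) => y z; rewrite !mxE.
have pxF : lmi_cone A (p - x).
  apply/lmi_coneP => w.
  by apply: (quad _ _ (dot_ge0 (joint_form A w))) => t t0 _; exact: var.
(* Here [p] is moved towards the origin, to (1 - t)p. *)
have pp : 0 <= - dot p (p - x).
  apply: (quad _ _ (dot_ge0 p)) => t t0 t1.
  have -> : t * (2 * (- dot p (p - x)) + t * dot p p) =
            (- t) * (2 * dot p (p - x) + (- t) * dot p p) by ring.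
  rewrite -(lerD2l (\sum_j (p 0 j - x 0 j) ^+ 2)) addr0 -dot_exp.
  apply: le_trans (w0min ((Num.sqrt (1 - t))%:C%C *: w0)) _.
  rewrite joint_formZ ?subr_ge0 //.
  by apply: ler_sum => j _; rewrite mxE mulrBl mul1r mulNr.
have xd : 0 <= dot x (p - x) := xdual _ pxF.
have d0 : dot (p - x) (p - x) = 0.
  apply/eqP; rewrite eq_le dot_ge0 andbT.
  have -> : dot (p - x) (p - x) = dot p (p - x) - dot x (p - x).
    by rewrite /dot -sumrB; apply: eq_bigr => j _; rewrite !mxE mulrBl.
  by rewrite subr_le0; lra.
apply/rowP => j; apply/eqP; rewrite eq_sym -subr_eq0 -sqrf_eq0 expr2.
have := psumr_eq0P _ d0 => /(_ _ j isT); rewrite !mxE => -> // i _.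
by rewrite -expr2 sqr_ge0.
Qed.

End Closest.

Local Open Scope complex_scope.

Theorem lemma1 (R : realType) (n : nat) (hn : (1 <= n)%N) (A : 'M[R[i]]_n) :
  dual_cone (lmi_cone A) = psd_image A /\
  (forall x1 x2 : R,
     numerical_range A (x1 +i* x2) <->
     dual_cone (lmi_cone A) (point3 1 x1 x2)).
Proof.
split.
  apply/seteqP; split; last exact: psd_image_dual.
  (* Every point of the dual cone is thus the image of a matrix of rank at most one. *)
  by move=> x /dual_cone_joint_form[w ->]; exact: joint_form_psd_image.
move=> x1 x2; rewrite numerical_rangeP dual_cone_joint_form.
by split=> -[w wE]; exists w.
Qed.
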